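(* Let $p\in(\tfrac14,\tfrac13]$ and let $\mathbf s\in\mathds{S}=\prod_{k=0}^\infty\{0,1\}^{4^k}$. Then the Hausdorff dimension of the generalised $p$-Koch curve $\mathcal C(\mathbf s)\subset\mathbb R^2$ is $$\dim_{\mathcal H}(\mathcal C(\mathbf s))=\frac{\log(4)}{\log(p^{-1})}.$$
   Context: Notation: $\mathbb N=\{1,2,\dots\}$, $\mathbb N_0=\mathbb N\cup\{0\}$, $p\in(\tfrac14,\tfrac13]$, $q=\sqrt{4p-1}$. $V\subset\mathbb R^2$ is the closed filled-in rhombus (closed convex hull) with vertices $P_\pm=(\pm\tfrac12,0)$ and $Q_\pm=(0,\pm\tfrac12 q)$. Maps: for $(a,b)\in A=\{0,1,2,3\}\times\{0,1\}$ the affine maps $\phi_{(a,b)}$ (which map $V$ into $V$) are $\phi_{(0,0)}(x,y)=\phi_{(0,1)}(x,y)=(px-\tfrac{1-p}{2},\,py)$; $\phi_{(3,0)}(x,y)=\phi_{(3,1)}(x,y)=(px+\tfrac{1-p}{2},\,py)$; $\phi_{(1,0)}(x,y)=\big(\tfrac12((1-2p)x-qy)+\tfrac{2p-1}{4},\ \tfrac12(qx+(1-2p)y)+\tfrac q4\big)$; $\phi_{(2,0)}(x,y)=\big(\tfrac12((1-2p)x+qy)+\tfrac{1-2p}{4},\ \tfrac12(-qx+(1-2p)y)+\tfrac q4\big)$; $\phi_{(1,1)}(x,y)=\big(\tfrac12((1-2p)x+qy)+\tfrac{2p-1}{4},\ \tfrac12(-qx+(1-2p)y)-\tfrac q4\big)$;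 $\phi_{(2,1)}(x,y)=\big(\tfrac12((1-2p)x-qy)+\tfrac{1-2p}{4},\ \tfrac12(qx+(1-2p)y)-\tfrac q4\big)$. Generalised $p$-Koch curves: an element $\mathbf s\in\mathds S=\prod_{k=0}^\infty\{0,1\}^{4^k}$ is written $\mathbf s=((s_k(0),s_k(1),\dots,s_k(4^k-1)))_{k=0}^\infty$ with $s_k(i)\in\{0,1\}$. For $\mathbf u=(u_k)_{k\in\mathbb N}\in\{0,1,2,3\}^{\mathbb N}$ put $\omega_1(\mathbf u,\mathbf s)=(u_1,s_0(0))$ and, for $k\ge2$, $\omega_k(\mathbf u,\mathbf s)=\big(u_k,\,s_{k-1}(\sum_{j=1}^{k-1}u_j4^{k-1-j})\big)\in A$. Let $\Sigma(\mathbf s)=\{(\omega_k(\mathbf u,\mathbf s))_{k\in\mathbb N}:\mathbf u\in\{0,1,2,3\}^{\mathbb N}\}\subset A^{\mathbb N}$. The generalised $p$-Koch curve associated with $\mathbf s$ is $$\mathcal C(\mathbf s)=\bigcup_{(\omega_k)_{k\in\mathbb N}\in\Sigma(\mathbf s)}\ \bigcap_{k\in\mathbb N}(\phi_{\omega_1}\circ\phi_{\omega_2}\circ\cdots\circ\phi_{\omega_k})(V).$$ *)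

(* Defs.v *)
From HB Require Import structures.
From mathcomp Require Import all_boot all_order all_algebra.
From mathcomp Require Import all_classical all_reals all_analysis.

Set Implicit Arguments.
Unset Strict Implicit.
Unset Printing Implicit Defensive.

Import Order.TTheory GRing.Theory Num.Theory.
Import numFieldNormedType.Exports.

Local Open Scope classical_set_scope.
Local Open Scope ring_scope.

(** * Hausdorff dimension with respect to a distance [d] *)

(* The element 0 only matters for the empty set, whose diameter is thus 0. *)
Definition diam (R : realType) (T : Type) (d : T -> T -> R) (U : set T)
    : \bar R :=
  ereal_sup (0%E |` [set (d x y)%:E | x in U & y in U]).

(* |U|^t, with the conventions that the empty set contributes 0 and that
   0^0 = 1 for nonempty U; both only matter when t = 0, where they make the
   measure below the counting measure. *)
Definition diam_pow (R : realType) (T : Type) (d : T -> T -> R) (t : R)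
    (U : set T) : \bar R :=
  if U == set0 then 0%E else poweR (diam d U) t.

Definition delta_cover (R : realType) (T : Type) (d : T -> T -> R) (delta : R)
    (A : set T) (U : nat -> set T) : Prop :=
  (forall i, (diam d (U i) <= delta%:E)%E) /\ A `<=` \bigcup_i U i.

Definition hausdorff_content (R : realType) (T : Type) (d : T -> T -> R)
    (t delta : R) (A : set T) : \bar R :=
  ereal_inf [set (\sum_(0 <= i <oo) diam_pow d t (U i))%E
            | U in [set U : nat -> set T | delta_cover d delta A U]].

(* The content is nonincreasing in delta, so this supremum is its limit as
   delta tends to 0 from above. *)
Definition hausdorff_measure (R : realType) (T : Type) (d : T -> T -> R)
    (t : R) (A : set T) : \bar R :=
  ereal_sup [set hausdorff_content d t delta A
            | delta in [set delta : R | 0 < delta]].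

Definition hausdorff_dim (R : realType) (T : Type) (d : T -> T -> R)
    (A : set T) : \bar R :=
  ereal_inf [set t%:E
            | t in [set t : R | 0 <= t /\ hausdorff_measure d t A = 0%E]].

(** * The Euclidean plane *)

(* R^o is R as a module over itself, so that the plane is an R-module and
   [convex_set] applies; its library norm is the sup norm, hence the explicit
   Euclidean distance. *)
Definition plane (R : realType) : Type := (R^o * R^o)%type.

Definition eucl_dist (R : realType) (z w : plane R) : R :=
  Num.sqrt ((z.1 - w.1) ^+ 2 + (z.2 - w.2) ^+ 2).

Definition closed_convex_hull (R : realType) (A : set (R^o * R^o))
    : set (plane R) :=
  smallest [set B : set (R^o * R^o) | closed B /\ convex_set B] A.

(** * Generalised p-Koch curves *)

Definition koch_q (R : realType) (p : R) : R := Num.sqrt (4 * p - 1).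

Definition rhombus (R : realType) (p : R) : set (plane R) :=
  closed_convex_hull
    [set ((- (1 / 2), 0) : R^o * R^o); (1 / 2, 0);
         (0, 1 / 2 * koch_q p); (0, - (1 / 2 * koch_q p))].

(* The alphabet {0,1,2,3} x {0,1}; [false] stands for 0 and [true] for 1. *)
Definition letter : Type := ('I_4 * bool)%type.

Definition phi (R : realType) (p : R) (a : letter) (z : plane R) : plane R :=
  let q := koch_q p in
  let: (x, y) := z in
  match val a.1, a.2 with
  | 0%N, _ => (p * x - (1 - p) / 2, p * y)
  | 1%N, false => (1 / 2 * ((1 - 2 * p) * x - q * y) + (2 * p - 1) / 4,
                   1 / 2 * (q * x + (1 - 2 * p) * y) + q / 4)
  | 2%N, false => (1 / 2 * ((1 - 2 * p) * x + q * y) + (1 - 2 * p) / 4,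
                   1 / 2 * (- q * x + (1 - 2 * p) * y) + q / 4)
  | 1%N, true => (1 / 2 * ((1 - 2 * p) * x + q * y) + (2 * p - 1) / 4,
                  1 / 2 * (- q * x + (1 - 2 * p) * y) - q / 4)
  | 2%N, true => (1 / 2 * ((1 - 2 * p) * x - q * y) + (1 - 2 * p) / 4,
                  1 / 2 * (q * x + (1 - 2 * p) * y) - q / 4)
  | _, _ => (p * x + (1 - p) / 2, p * y)
  end.

Definition signs : Type := forall k : nat, {ffun 'I_(4 ^ k) -> bool}.

(* Sequences u_1, u_2, ... indexed by the positive integers are represented as
   functions on nat shifted by one: [u j] is u_(j+1). In this indexing
   [address u k] is the sum of u_j 4^(k-j) over 1 <= j <= k. *)
Definition address (u : nat -> 'I_4) (k : nat) : nat :=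
  (\sum_(j < k) u j * 4 ^ (k - j.+1))%N.

Lemma address_lt (u : nat -> 'I_4) (k : nat) : (address u k < 4 ^ k)%N.
Proof.
elim: k => [|k IHk]; first by rewrite /address big_ord0.
have -> : address u k.+1 = (4 * address u k + u k)%N.
  rewrite /address big_ord_recr /= subnn muln1 big_distrr /=; congr (_ + _)%N.
  apply: eq_bigr => j _.
  by rewrite subSn ?ltn_ord// expnS mulnCA.
rewrite expnS (@leq_trans (4 * (address u k).+1))//.
  by rewrite mulnS addnC -addSn leq_add2r ltn_ord.
by rewrite leq_mul2l IHk.
Qed.

(* [omega u s k] is omega_(k+1)(u, s). *)
Definition omega (u : nat -> 'I_4) (s : signs) (k : nat) : letter :=
  (u k, s k (Ordinal (address_lt u k))).

Definition Sigma (s : signs) : set (nat -> letter) :=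
  [set omega u s | u in [set: nat -> 'I_4]].

Definition phi_word (R : realType) (p : R) (w : nat -> letter) (k : nat)
    : plane R -> plane R :=
  \big[(fun f g => f \o g)/idfun]_(i < k) phi p (w i).

Definition koch_curve (R : realType) (p : R) (s : signs) : set (plane R) :=
  \bigcup_(w in Sigma s) \bigcap_(k in [set k | (0 < k)%N])
    (phi_word p w k @` rhombus p).

(* Main.v *)
Require Import Defs.
From mathcomp Require Import all_boot all_order all_algebra.
From mathcomp Require Import all_classical all_reals all_analysis.
From mathcomp Require Import ring lra.

(** Write V for the rhombus and D for the claimed dimension, so that p^D = 1/4.
Every map phi is a similarity of ratio p sending V into V, and V has diameter 1.

The curve is covered by its 4^k pieces of level k, which are similar copies of
V of diameter at most p^k. Hence its t-dimensional content at scale p^k is at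
most (4 p^t)^k, which tends to 0 when t > D ([hausdorff_measure_eq0]).

For the converse, the pieces of one level do not accumulate. The condition
p <= 1/3 enters here: it says that the four first-level pieces lie in four
consecutive vertical strips, whatever the sign bits ([phi_abscissa]). Keeping
track of how far the centre of a piece stays from the boundary of V
([phi_shrunk_rhombus]), one finds that the centres of two pieces of level k are
at distance at least p^k / 2 ([centre_separated]). By pigeonhole on a grid, a set
of diameter at most p^k meets at most 625 pieces of level k ([separated_card]).

Now code the points of the curve by base-4 expansions of x in [0, 1): a piece of
level k corresponds to a 4-adic interval of length 4^-k, so the set of all x
coding a point of U has outer length at most 625 / 4^k when U has diameter at
most p^k ([length_preimage]). For t < D this is at most 2500 |U|^t
([length_preimage_diam]). Every x codes some point, so for a cover of the curve
these sets cover [0, 1), and countable subadditivity of the outer length bounds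
the sum of the |U|^t from below by 1/2500. The t-dimensional measure is thus
nonzero ([le_of_hausdorff_measure_eq0]). *)

Import Order.TTheory GRing.Theory Num.Theory.
Import numFieldNormedType.Exports.

Local Open Scope classical_set_scope.
Local Open Scope ring_scope.

(** * The rhombus and the similarities *)

(** The concentric copy of V scaled by 1 - 2h. Its points are those that stay
at distance at least a fixed multiple of h from the boundary of V, so h measures
depth inside V. *)
Definition shrunk_rhombus {R : realType} (p h : R) : set (plane R) :=
  [set z | koch_q p * `|z.1| + `|z.2| <= koch_q p * (1 / 2 - h)].

(** Abscissae of the vertices of the generating polygonal line: P_-, then the
left foot, the apex and the right foot of the middle tooth, then P_+. *)
Definition piece_end {R : realType} (p : R) (n : nat) : R :=
  nth 0 [:: - (1 / 2); - ((1 - 2 * p) / 2); 0; (1 - 2 * p) / 2; 1 / 2] n.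

Section geometry.
Context {R : realType} {p : R} (hp : 1 / 4 < p <= 1 / 3).
Implicit Types (z w : plane R) (a b : letter) (h x y : R).
Local Notation q := (koch_q p).

Lemma koch_q_sqr : q ^+ 2 = 4 * p - 1.
Proof. by rewrite sqr_sqrtr//; move: hp; lra. Qed.

Lemma koch_q_gt0 : 0 < q.
Proof. by rewrite sqrtr_gt0; move: hp; lra. Qed.

Lemma koch_q_le1 : q <= 1.
Proof. by have := koch_q_gt0; have := koch_q_sqr; move: hp; nra. Qed.

(** Without absolute values, the rhombus becomes accessible to linear
arithmetic in the monomials of p, q, h and the coordinates. *)
Lemma shrunk_rhombusP h x y :
  shrunk_rhombus p h (x, y) <->
  [/\ q * x + y <= q * (1 / 2 - h), q * x - y <= q * (1 / 2 - h),
      - (q * x) + y <= q * (1 / 2 - h) & - (q * x) - y <= q * (1 / 2 - h)].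
Proof.
rewrite /shrunk_rhombus /=; have q0 := koch_q_gt0.
have -> : q * `|x| = `|q * x| by rewrite normrM gtr0_norm.
split.
  move=> H; have := ler_norm (q * x); have := ler_norm y.
  have := ler_norm (- (q * x)); have := ler_norm (- y); rewrite !normrN => *.
  by split; lra.
move=> [? ? ? ?]; by case: (ger0P (q * x)) => ?; case: (ger0P y) => ?; lra.
Qed.

(** A map phi carries V into V and multiplies distances by p, so the depth
inside V is at least p times what it was. In coordinates, each of the four
inequalities for the image follows from the four for z, taken with coefficients p
and 1 - 2 p, once q^2 is replaced by 4 p - 1. *)
Lemma phi_shrunk_rhombus a h z : 0 <= h ->
  shrunk_rhombus p h z -> shrunk_rhombus p (p * h) (phi p a z).
Proof.
case: z => x y h0 /shrunk_rhombusP[f1 f2 f3 f4].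
have q0 := koch_q_gt0; have q2 := koch_q_sqr.
have p0 : 0 <= p by move: hp; lra.
have p2 : 0 <= 1 - 2 * p by move: hp; lra.
have qx : q ^+ 2 * x = (4 * p - 1) * x by rewrite q2.
have qy : q ^+ 2 * y = (4 * p - 1) * y by rewrite q2.
have qh : 0 <= (1 - 2 * p) * (q * h) by rewrite !mulr_ge0// ltW.
have pq : 0 <= p * q by rewrite !mulr_ge0// ltW.
have pq' : 0 <= (1 - 2 * p) * q by rewrite !mulr_ge0// ltW.
have := (ler_wpM2l p0 f1, ler_wpM2l p0 f2, ler_wpM2l p0 f3, ler_wpM2l p0 f4).
have := (ler_wpM2l p2 f1, ler_wpM2l p2 f2, ler_wpM2l p2 f3, ler_wpM2l p2 f4).
move=> [[[g1 g2] g3] g4] [[[k1 k2] k3] k4];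
case: a => [[[|[|[|[|//]]]] ?] []]; rewrite /phi /=; apply/shrunk_rhombusP;
  clear f1 f2 f3 f4 hp p0 p2 h0 q0 q2; split; lra.
Qed.

(** The four images of V lie in consecutive vertical strips. For the two middle
letters the rhombus leaves the corresponding foot in directions up to three times
the half-angle of V at P_-; that half-angle is at most 30 degrees exactly when
p <= 1/3. The coefficient 1 - 3 p in the proof is this condition. *)
Lemma phi_abscissa a h z : 0 <= h -> shrunk_rhombus p h z ->
  piece_end p a.1 + p * h / 2 <= (phi p a z).1 <= piece_end p a.1.+1 - p * h / 2.
Proof.
case: z => x y h0 /shrunk_rhombusP[f1 f2 f3 f4].
have q0 := koch_q_gt0; have q2 := koch_q_sqr.
have p0 : 0 <= p by move: hp; lra.
have p3 : 0 <= 1 - 3 * p by move: hp; lra.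
have qy : q ^+ 2 * y = (4 * p - 1) * y by rewrite q2.
have qh : 0 <= (1 - 3 * p) * (q * h) by rewrite !mulr_ge0// ltW.
have qh' : 0 <= p * (q * h) by rewrite !mulr_ge0// ltW.
have := (ler_wpM2l p0 f1, ler_wpM2l p0 f2, ler_wpM2l p0 f3, ler_wpM2l p0 f4).
have := (ler_wpM2l p3 f1, ler_wpM2l p3 f2, ler_wpM2l p3 f3, ler_wpM2l p3 f4).
move=> [[[g1 g2] g3] g4] [[[k1 k2] k3] k4]; clear f1 f2 f3 f4 hp p0 p3 h0.
rewrite -[X in X && _](ler_pM2l q0) -[X in _ && X](ler_pM2l q0); clear q0 q2.
by case: a => [[[|[|[|[|//]]]] ?] []] /=; rewrite /piece_end /=;
  apply/andP; split; lra.
Qed.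

Lemma phi_separated a b h z w : (a.1 < b.1)%N -> 0 <= h ->
  shrunk_rhombus p h z -> shrunk_rhombus p h w ->
  (phi p a z).1 + p * h <= (phi p b w).1.
Proof.
move=> ab h0 /(phi_abscissa a _ _ h0)/andP[_ +] /(phi_abscissa b _ _ h0)/andP[+ _].
have : piece_end p a.1.+1 <= piece_end p b.1.
  case: a b ab => [[[|[|[|[|//]]]] ?] ?] [[[|[|[|[|//]]]] ?] ?] //= _;
    rewrite /piece_end/=; move: hp; lra.
lra.
Qed.

(** The middle letters act by a rotation scaled by p, because
(1 - 2 p)^2 + q^2 = (2 p)^2. *)
Lemma eucl_dist_phi a z w :
  eucl_dist (phi p a z) (phi p a w) = p * eucl_dist z w.
Proof.
case: z w => x y [x' y']; have q2 := koch_q_sqr.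
have p0 : 0 <= p by move: hp; lra.
rewrite /eucl_dist -[X in _ = X * _](ger0_norm p0) -sqrtr_sqr -sqrtrM ?sqr_ge0//.
congr Num.sqrt.
have : q ^+ 2 * ((x - x') ^+ 2 + (y - y') ^+ 2) =
  (4 * p - 1) * ((x - x') ^+ 2 + (y - y') ^+ 2) by rewrite q2.
by case: a => [[[|[|[|[|//]]]] ?] []]; rewrite /phi /= => ?; lra.
Qed.

(** As q <= 1, V lies in the ball of radius 1/2 for the sum norm, which
dominates the Euclidean norm. *)
Lemma eucl_dist_shrunk_rhombus z w :
  shrunk_rhombus p 0 z -> shrunk_rhombus p 0 w -> eucl_dist z w <= 1.
Proof.
case: z w => x y [x' y']; rewrite /shrunk_rhombus /eucl_dist /=.
have q0 := koch_q_gt0; have q1 := koch_q_le1 => f f'.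
rewrite -sqrtr1 ler_sqrt//.
have [X Y] : `|x| + `|y| <= 1 / 2 /\ `|x'| + `|y'| <= 1 / 2.
  by have := (normr_ge0 x, normr_ge0 y, normr_ge0 x', normr_ge0 y') =>
    -[[[? ?] ?] ?]; split; nra.
have := ler_normB x x'; have := ler_normB y y'.
rewrite -(real_normK (num_real (x - x'))) -(real_normK (num_real (y - y'))).
have := normr_ge0 (x - x'); have := normr_ge0 (y - y'); nra.
Qed.

Lemma closed_shrunk_rhombus h : closed (shrunk_rhombus p h : set (R^o * R^o)).
Proof.
apply: (@closed_comp _ _ (fun z : R^o * R^o => q * `|z.1| + `|z.2|)
  [set t | t <= q * (1 / 2 - h)]); last exact: closed_le.
move=> z _; apply: cvgD; last by apply: cvg_norm; exact: cvg_snd.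
by apply: cvgM; [exact: cvg_cst|apply: cvg_norm; exact: cvg_fst].
Qed.

Lemma convex_shrunk_rhombus h :
  convex_set (shrunk_rhombus p h : set (R^o * R^o)).
Proof.
move=> [x y] [x' y'] l; rewrite !inE => /shrunk_rhombusP[f1 f2 f3 f4].
move=> /shrunk_rhombusP[f1' f2' f3' f4'].
have l0 : 0 <= l%:num by [].
have l1 : 0 <= 1 - l%:num by rewrite subr_ge0.
have := (ler_wpM2l l0 f1, ler_wpM2l l0 f2, ler_wpM2l l0 f3, ler_wpM2l l0 f4).
have := (ler_wpM2l l1 f1', ler_wpM2l l1 f2', ler_wpM2l l1 f3', ler_wpM2l l1 f4').
move=> [[[g1 g2] g3] g4] [[[k1 k2] k3] k4].
apply/(shrunk_rhombusP h (l%:num * x + (1 - l%:num) * x')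
                         (l%:num * y + (1 - l%:num) * y')).
by clear f1 f2 f3 f4 f1' f2' f3' f4' hp l0 l1; split; lra.
Qed.

(** For the inclusion of the explicit rhombus in the hull, write a point (x, y)
as a convex combination of (+-1/2, 0) with weight t = 2 |x| and of a point (0, v)
of the vertical diagonal. *)
Lemma rhombusE : rhombus p = shrunk_rhombus p 0.
Proof.
have q0 := koch_q_gt0; apply/seteqP; split.
  apply: smallest_sub.
    by split; [exact: closed_shrunk_rhombus|exact: convex_shrunk_rhombus].
  have q1 : `|1 / 2 * q| = 1 / 2 * q by rewrite gtr0_norm// mulr_gt0.
  have n2 : `|1 / 2 : R| = 1 / 2 by rewrite gtr0_norm.
  by move=> _ [[[->|->]|->]|->]; rewrite /shrunk_rhombus /= ?normrN ?q1 ?n2 ?normr0; lra.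
move=> [x y] xyV B [[_ convB] AB].
have conv2 z w (t : R) : B z -> B w -> 0 <= t <= 1 ->
    B (t * z.1 + (1 - t) * w.1, t * z.2 + (1 - t) * w.2).
  move=> Bz Bw /andP[t0 t1].
  by have := convB z w (Itv01 t0 t1); rewrite !inE => /(_ Bz Bw).
have BP c : `|c| = 1 -> B (c / 2, 0).
  case: (ger0P c) => _ c1; apply: AB => /=.
    by left; left; right; rewrite c1.
  by left; left; left; congr (_, _); lra.
have BQ v : `|v| <= q / 2 -> B (0, v).
  rewrite ler_norml => /andP[v1 v2].
  have t01 : 0 <= v / q + 1 / 2 <= 1.
    have : v / q <= 1 / 2 by rewrite ler_pdivrMr//; lra.
    have : - (1 / 2) <= v / q by rewrite ler_pdivlMr//; lra.
    by move=> *; apply/andP; split; lra.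
  have BQ1 : B (0, 1 / 2 * q) by apply: AB; left; right.
  have BQ2 : B (0, - (1 / 2 * q)) by apply: AB; right.
  have := conv2 _ _ _ BQ1 BQ2 t01 => /=; congr (B (_, _)); first by rewrite !mulr0 addr0.
  by field; rewrite gt_eqF.
have [t x2] : {t | t = 2 * `|x|} by eexists.
have qx := normr_ge0 x; have qy := normr_ge0 y.
move: xyV; rewrite /shrunk_rhombus /= subr0 => xyV.
have t1 : t <= 1 by rewrite -(ler_pM2l q0); nra.
have t01 : 0 <= t <= 1 by apply/andP; split => //; lra.
have [c c1 xc] : exists2 c : R, `|c| = 1 & x = t * (c / 2).
  rewrite x2; case: (ger0P x) => _; [exists 1|exists (- 1)]; rewrite ?normrN ?normr1//; lra.
have [v vq yv] : exists2 v : R, `|v| <= q / 2 & y = (1 - t) * v.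
  (* For t = 1 the point is a vertex and v is arbitrary. *)
  have [tE|tN1] := eqVneq t 1.
    exists 0; first by rewrite normr0; lra.
    by rewrite mulr0; apply/normr0_eq0/le_anti/andP; split => //; rewrite x2 in tE; nra.
  have t1' : 0 < 1 - t by rewrite subr_gt0 lt_neqAle tN1.
  exists (y / (1 - t)); last by rewrite mulrC divfK// gt_eqF.
  by rewrite normrM normfV (gtr0_norm t1') ler_pdivrMr// x2; nra.
have := conv2 _ _ _ (BP c c1) (BQ v vq) t01 => /=.
by rewrite -xc -yv !mulr0 addr0 add0r.
Qed.

End geometry.
(** * Words, addresses and the distance *)

Section words.
Context {R : realType}.
Implicit Types (p : R) (z : plane R) (w : nat -> letter) (u v : nat -> 'I_4).

Lemma phi_word_recl p w k z :
  phi_word p w k.+1 z = phi p (w 0%N) (phi_word p (fun i => w i.+1) k z).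
Proof. by rewrite /phi_word big_ord_recl. Qed.

Lemma phi_word_add p w j m z :
  phi_word p w (j + m) z = phi_word p w j (phi_word p (fun i => w (j + i)%N) m z).
Proof.
elim: j w => [|j IHj] w; first by rewrite {2}/phi_word big_ord0.
by rewrite addSn !phi_word_recl IHj.
Qed.

Lemma eq_phi_word p w w' k :
  (forall i, (i < k)%N -> w i = w' i) -> phi_word p w k = phi_word p w' k.
Proof. by move=> ww'; apply: eq_bigr => i _; rewrite ww'. Qed.

Lemma addressS u k : address u k.+1 = (4 * address u k + u k)%N.
Proof.
rewrite /address big_ord_recr /= subnn muln1 big_distrr /=; congr (_ + _)%N.
apply: eq_bigr => j _.
by rewrite subSn ?ltn_ord// expnS mulnCA.
Qed.

Lemma eq_address u v k :
  (forall i, (i < k)%N -> u i = v i) -> address u k = address v k.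
Proof. by move=> uv; apply: eq_bigr => i _; rewrite uv. Qed.

Lemma address_inj u v k :
  address u k = address v k -> forall i, (i < k)%N -> u i = v i.
Proof.
elim: k => [//|k IHk]; rewrite !addressS => uv i.
have uvk : u k = v k :> nat.
  by have := congr1 (modn^~ 4) uv; rewrite !(mulnC 4) !modnMDl !modn_small.
rewrite ltnS leq_eqVlt => /predU1P[->|]; first exact: val_inj.
by apply: IHk; move: uv; rewrite uvk => /addIn/eqP; rewrite eqn_mul2l => /eqP.
Qed.

Lemma eq_omega (s : signs) u v k :
  (forall i, (i <= k)%N -> u i = v i) -> omega u s k = omega v s k.
Proof.
move=> uv; rewrite /omega uv//; congr (_, s k _); apply: val_inj => /=.
by apply: eq_address => i /ltnW/uv.
Qed.

(** A piece of level k depends on the digits only through the address, since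
each sign bit is read at the address of a shorter prefix. *)
Lemma eq_phi_omega p (s : signs) u v k : address u k = address v k ->
  phi_word p (omega u s) k = phi_word p (omega v s) k.
Proof.
move=> /address_inj uv; apply: eq_phi_word => i ik; apply: eq_omega => j ji.
exact/uv/(leq_ltn_trans ji).
Qed.

End words.

Section distance.
Context {R : realType}.
Implicit Types (z w : plane R).

Lemma eucl_distC z w : eucl_dist z w = eucl_dist w z.
Proof. by rewrite /eucl_dist -sqrrN opprB -(sqrrN (z.2 - _)) opprB. Qed.

Lemma le_dx_eucl_dist z w : `|z.1 - w.1| <= eucl_dist z w.
Proof. by rewrite -sqrtr_sqr ler_wsqrtr// lerDl sqr_ge0. Qed.

Lemma le_dy_eucl_dist z w : `|z.2 - w.2| <= eucl_dist z w.
Proof. by rewrite -sqrtr_sqr ler_wsqrtr// lerDr sqr_ge0. Qed.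

Lemma eucl_dist_le z w : eucl_dist z w <= `|z.1 - w.1| + `|z.2 - w.2|.
Proof.
rewrite -(ger0_norm (addr_ge0 (normr_ge0 (z.1 - w.1)) (normr_ge0 (z.2 - w.2)))).
rewrite -sqrtr_sqr ler_wsqrtr// (sqrrD `|_|) !real_normK ?num_real//.
by rewrite lerD2r lerDl mulrn_wge0// mulr_ge0.
Qed.

End distance.

(** * Pieces and their centres *)

Section pieces.
Context {R : realType} {p : R} (hp : 1 / 4 < p <= 1 / 3).
Implicit Types (z : plane R) (w : nat -> letter) (u v : nat -> 'I_4) (h : R).
Implicit Types (s : signs).

Let p0 : 0 < p. Proof. by move: hp; lra. Qed.

(** In particular, the centre of a piece of level k has depth of order p^k. *)
Lemma phi_word_shrunk_rhombus w k h z : 0 <= h ->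
  shrunk_rhombus p h z -> shrunk_rhombus p (p ^+ k * h) (phi_word p w k z).
Proof.
elim: k w => [|k IHk] w h0 zh; first by rewrite /phi_word big_ord0 mul1r.
rewrite phi_word_recl exprS -mulrA; apply: phi_shrunk_rhombus => //; last exact: IHk.
by rewrite mulr_ge0// exprn_ge0// ltW.
Qed.

Lemma eucl_dist_phi_word w k z z' :
  eucl_dist (phi_word p w k z) (phi_word p w k z') = p ^+ k * eucl_dist z z'.
Proof.
elim: k w => [|k IHk] w; first by rewrite /phi_word big_ord0 mul1r.
by rewrite !phi_word_recl eucl_dist_phi// IHk exprS mulrA.
Qed.

Definition centre p s u k : plane R := phi_word p (omega u s) k (0, 0).

Lemma shrunk_rhombus_centre : shrunk_rhombus p (1 / 2) (0, 0).
Proof. by rewrite /shrunk_rhombus /= subrr normr0 !mulr0 addr0. Qed.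

(** At the first digit where u and v differ, the common prefix only rescales
distances, and the two images lie in distinct strips; each centre keeps away from
the boundary of its strip by its depth. *)
Lemma centre_separated s u v k : address u k <> address v k ->
  p ^+ k / 2 <= eucl_dist (centre p s u k) (centre p s v k).
Proof.
move=> uv.
have [|j /andP[jk ujvj] jmin] := @ex_minnP (fun j => (j < k)%N && (u j != v j)).
  apply/not_existsP => H; apply: uv; apply: eq_address => i ik.
  by apply/eqP/negPn/negP => uvi; apply: (H i); rewrite ik.
have uvj i : (i < j)%N -> u i = v i.
  move=> ij; apply/eqP/negPn/negP => uvi.
  have := jmin i; rewrite (ltn_trans ij jk) uvi => /(_ isT).
  by rewrite leqNgt ij.
wlog lt_uv : u v uv ujvj uvj jmin / (u j < v j)%N.
  move=> H; move: (ujvj); rewrite -val_eqE neq_ltn => /orP[uvlt|vult]; first exact: H.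
  rewrite eucl_distC; apply: H => //; first by move=> /esym.
  - by rewrite eq_sym.
  - by move=> i /uvj.
  - by move=> i; rewrite eq_sym; exact: jmin.
have kE : k = (j + (k - j.+1).+1)%N by rewrite addnS -addSn subnKC.
move: (k - j.+1)%N kE => m ->; rewrite /centre !phi_word_add.
have -> : phi_word p (omega v s) j = phi_word p (omega u s) j.
  by apply: eq_phi_omega; apply: eq_address => i /uvj.
rewrite eucl_dist_phi_word exprD -mulrA ler_pM2l ?exprn_gt0//.
rewrite !phi_word_recl addn0 exprS.
apply: le_trans (le_dx_eucl_dist _ _); rewrite distrC ler_normr; apply/orP; left.
have m0 : 0 <= p ^+ m * (1 / 2) by rewrite mulr_ge0// exprn_ge0// ltW.
have := phi_separated hp (omega u s j) (omega v s j) _ _ _ lt_uv m0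
  (phi_word_shrunk_rhombus _ _ _ _ _ shrunk_rhombus_centre)
  (phi_word_shrunk_rhombus _ _ _ _ _ shrunk_rhombus_centre).
have h0 : 0 <= 1 / 2 :> R by [].
move=> /(_ (fun i => omega u s (j + i.+1)%N) (fun i => omega v s (j + i.+1)%N) h0 h0).
lra.
Qed.

(** An affine map is determined by its values at the origin and at the two unit
vectors, which gives one formula for all letters. *)
Lemma continuous_phi a : continuous (phi p a : R^o * R^o -> R^o * R^o).
Proof.
have affine (b c d e f g : R) : continuous
    (fun z : R^o * R^o => (b * z.1 + c * z.2 + d, e * z.1 + f * z.2 + g)
       : R^o * R^o).
  have aff1 (b' c' d' : R) :
      continuous (fun z : R^o * R^o => b' * z.1 + c' * z.2 + d' : R^o).
    move=> z; apply: cvgD; last exact: cvg_cst.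
    apply: cvgD; apply: cvgM; [exact: cvg_cst|exact: cvg_fst|exact: cvg_cst|exact: cvg_snd].
  by move=> z; apply: (@cvg_pair _ _ _ _ (nbhs _) (nbhs _)); exact: aff1.
have -> : phi p a = (fun z : R^o * R^o =>
    (((phi p a (1, 0)).1 - (phi p a (0, 0)).1) * z.1 +
     ((phi p a (0, 1)).1 - (phi p a (0, 0)).1) * z.2 + (phi p a (0, 0)).1,
     ((phi p a (1, 0)).2 - (phi p a (0, 0)).2) * z.1 +
     ((phi p a (0, 1)).2 - (phi p a (0, 0)).2) * z.2 + (phi p a (0, 0)).2)).
  apply/funext => -[x y].
  by case: a => [[[|[|[|[|//]]]] ?] []]; rewrite /phi /=; congr (_, _); ring.
exact: affine.
Qed.

Lemma continuous_phi_word w k :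
  continuous (phi_word p w k : R^o * R^o -> R^o * R^o).
Proof.
elim: k w => [|k IHk] w.
  by rewrite /phi_word big_ord0 => z; exact: cvg_id.
rewrite /phi_word big_ord_recl => z.
apply: continuous_comp; first exact: (IHk (fun i => w i.+1)).
exact: continuous_phi.
Qed.

Lemma compact_shrunk_rhombus : compact (shrunk_rhombus p 0 : set (R^o * R^o)).
Proof.
have q0 := koch_q_gt0 hp.
apply: (@subclosed_compact (R^o * R^o)%type _
  ((`[-1, 1] : set R^o) `*` (`[-1, 1] : set R^o))).
- exact: closed_shrunk_rhombus.
- by apply: compact_setX; exact: segment_compact.
- move=> [x y]; rewrite /shrunk_rhombus /= !in_itv /= -!ler_norml subr0.
  have := koch_q_le1 hp; have := normr_ge0 x; have := normr_ge0 y => ? ? ? ?.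
  by split; nra.
Qed.

(** Every digit sequence codes a point of the curve: a cluster point of the
centres lies in all pieces, as these are closed and decreasing. *)
Lemma nested_pieces u s : exists z, forall k,
  (phi_word p (omega u s) k @` shrunk_rhombus p 0) z.
Proof.
pose x k : R^o * R^o := centre p s u k.
have centre_in w k : shrunk_rhombus p 0 (phi_word p w k (0, 0)).
  have := phi_word_shrunk_rhombus w k 0 (0, 0) (lexx 0); rewrite mulr0; apply.
  rewrite /shrunk_rhombus /= normr0 mulr0 addr0 subr0 mulr_ge0//.
  exact/ltW/koch_q_gt0.
have xK k m : (k <= m)%N ->
    (phi_word p (omega u s) k @` shrunk_rhombus p 0) (x m).
  move=> /subnKC <-; move: (m - k)%N => {}m; rewrite /x /centre phi_word_add.
  exists (phi_word p (fun i => omega u s (k + i)%N) m (0, 0)) => //.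
have [|z [_ zx]] := @compact_shrunk_rhombus (x @ \oo) _.
  by exists 0%N => // k _; exact: centre_in.
exists z => k.
have cK : compact (phi_word p (omega u s) k @` shrunk_rhombus p 0 : set (R^o * R^o)).
  apply: continuous_compact; last exact: compact_shrunk_rhombus.
  by apply: continuous_subspaceT; exact: continuous_phi_word.
apply: (compact_closed _ cK) => [|B Bz]; first exact: norm_hausdorff.
by apply: (zx _ B _ Bz); exists k => // m /= /xK.
Qed.

End pieces.

(** * Packing in the plane *)

(** Measured from a fixed point of the family, all coordinates lie in
[-6 r, 6 r], which is divided into cells of side r / 2: at most 25 cells per
coordinate. Two points in the same square cell are at distance less than r, so
the map to cells is injective. *)
Lemma separated_card {R : realType} {T : finType} (S : {set T})
    (c : T -> plane R) (r : R) : 0 < r ->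
  {in S &, forall m n, m != n -> r <= eucl_dist (c m) (c n)} ->
  {in S &, forall m n, `|(c m).1 - (c n).1| <= 6 * r} ->
  {in S &, forall m n, `|(c m).2 - (c n).2| <= 6 * r} ->
  (#|S| <= 625)%N.
Proof.
move=> r0 sep near1 near2; have [->|[n0 n0S]] := set_0Vmem S; first by rewrite cards0.
pose cell (x : R) : 'I_25 := inord (Num.truncn ((x + 6 * r) / (r / 2))).
have cell_eq (x y : R) : `|x| <= 6 * r -> `|y| <= 6 * r -> cell x = cell y ->
    `|x - y| < r / 2.
  have r2 : 0 < r / 2 by rewrite divr_gt0.
  have cellE t : `|t| <= 6 * r ->
      (cell t)%:R <= (t + 6 * r) / (r / 2) < (cell t).+1%:R.
    rewrite ler_norml => /andP[t1 t2].
    have t0 : 0 <= (t + 6 * r) / (r / 2) by apply: divr_ge0; [lra|exact: ltW].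
    rewrite inordK; first exact: truncn_itv.
    rewrite -(ltr_nat R); apply: le_lt_trans (_ : 24%:R < _); last by rewrite ltr_nat.
    apply: (@le_trans _ _ ((t + 6 * r) / (r / 2))); first by rewrite truncn_le.
    by rewrite ler_pdivrMr//; lra.
  move=> /cellE/andP[x1 x2] /cellE/andP[y1 y2] xy; rewrite xy in x1 x2.
  rewrite ltr_norml -(ltr_pM2r (x := (r / 2)^-1)) ?invr_gt0//.
  rewrite -[X in _ && X](ltr_pM2r (x := (r / 2)^-1)) ?invr_gt0//.
  rewrite mulNr divff ?gt_eqF// mulrBl.
  move: x1 x2 y1 y2; rewrite (mulrDl x) (mulrDl y) -natr1 => *; apply/andP; split; lra.
pose f n := (cell ((c n).1 - (c n0).1), cell ((c n).2 - (c n0).2)).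
rewrite -(@card_in_imset _ _ f).
  by apply: leq_trans (max_card _) _; rewrite card_prod !card_ord.
move=> m n mS nS [] /cell_eq fx /cell_eq fy; apply/eqP/negPn/negP => mn.
have := sep _ _ mS nS mn; apply/negP; rewrite -ltNge.
apply: le_lt_trans (eucl_dist_le _ _) _; rewrite [r]splitr ltrD//.
- have -> : (c m).1 - (c n).1 = ((c m).1 - (c n0).1) - ((c n).1 - (c n0).1) by ring.
  by apply: fx; exact: near1.
- have -> : (c m).2 - (c n).2 = ((c m).2 - (c n0).2) - ((c n).2 - (c n0).2) by ring.
  by apply: fy; exact: near2.
Qed.
(** * Base-4 coding and outer length *)

Section outer_measure.
Context {R : realType}.
Implicit Types (A B : set R).

(** Lebesgue measure is this outer measure restricted to measurable sets. The
sets of codes measured below come without any measurability. *)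
Definition length_outer : {outer_measure set (ocitv_type R) -> \bar R} :=
  ((@wlength R idfun)^*)%mu.

Lemma length_outer_itv (a b : R) : a <= b ->
  length_outer `[a, b[%classic = (b - a)%:E.
Proof.
move=> ab; have -> : length_outer `[a, b[%classic = lebesgue_measure `[a, b[%classic by [].
rewrite lebesgue_measure_itv /= lte_fin EFinB.
by case: ltgtP ab => // -> _; rewrite -EFinB subrr.
Qed.

Lemma length_outer_cover (T : finType) (S : {set T}) (I : T -> set R) A (r : R) :
  (forall n, (length_outer (I n) <= r%:E)%E) ->
  (forall x, A x -> exists2 n, n \in S & I n x) ->
  (length_outer A <= (#|S|%:R * r)%:E)%E.
Proof.
move=> Ir AI; pose F i := nth set0 [seq I n | n <- enum S] i.
have AF : A `<=` \big[setU/set0]_(i < #|S|) F i.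
  rewrite -bigcup_mkord => x /AI[n nS Inx]; exists (index n (enum S)).
    by rewrite /= cardE index_mem mem_enum.
  by rewrite /F (nth_map n) ?nth_index ?index_mem ?mem_enum.
apply: le_trans (le_outer_measure _ _ _ AF) _.
apply: le_trans (outer_measure_subadditive _ _ _) _.
rewrite mulr_natl -[X in (_ *+ X)%:E]card_ord -sumr_const -sumEFin.
apply: lee_sum => i _; rewrite /F.
have iS : (i < size (enum S))%N by rewrite -cardE.
by case: (enum S) iS => // n e iS; rewrite (nth_map n).
Qed.

End outer_measure.

Section digits.
Context {R : realType}.
Implicit Types (x : R).

Definition digit x (j : nat) : 'I_4 := inord (Num.truncn (4 ^+ j.+1 * x) %% 4).

(** The address of the first k digits of x is the integer part of 4^k x: the
points with a given address form a 4-adic interval of length 4^-k. *)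
Lemma address_digit x k : 0 <= x < 1 ->
  address (digit x) k = Num.truncn (4 ^+ k * x).
Proof.
move=> /andP[x0 x1]; have e0 j : 0 <= 4 ^+ j * x :> R by rewrite mulr_ge0// exprn_ge0.
elim: k => [|k IHk].
  rewrite /address big_ord0; apply/esym/eqP.
  by rewrite truncn_eq// expr0 mul1r x0.
rewrite addressS IHk /digit inordK ?ltn_pmod//.
rewrite [RHS](divn_eq _ 4) mulnC; congr (_ * _ + _)%N.
apply/eqP; rewrite truncn_eq//; have := truncn_itv (e0 k.+1); rewrite exprS -mulrA.
set N := Num.truncn _ => /andP[N1 N2].
have M1 : (N %/ 4)%:R * 4 <= N%:R :> R.
  by rewrite -natrM ler_nat leq_trunc_div.
have M2 : N.+1%:R <= (N %/ 4).+1%:R * 4 :> R.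
  by rewrite -natrM ler_nat ltn_ceil.
by apply/andP; split; lra.
Qed.

End digits.

Section preimage.
Context {R : realType} {p : R} (hp : 1 / 4 < p <= 1 / 3) (s : signs).

Let p0 : 0 < p. Proof. by move: hp; lra. Qed.

(** The level 0 piece is included, contrary to the definition of the curve; as
the pieces decrease, the intersection is the same. *)
Definition coded_by (u : nat -> 'I_4) (z : plane R) : Prop :=
  forall k, (phi_word p (omega u s) k @` shrunk_rhombus p 0) z.

(** A relation rather than the inverse image under a coding function: it avoids
choosing the point coded by x. *)
Definition coding_preimage (U : set (plane R)) : set R :=
  [set x | 0 <= x < 1 /\ exists2 z, U z & coded_by (digit x) z].

Lemma eucl_dist_centre (u : nat -> 'I_4) z k : coded_by u z ->
  eucl_dist (centre p s u k) z <= p ^+ k.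
Proof.
move=> /(_ k)[z' z'V <-]; rewrite /centre eucl_dist_phi_word//.
rewrite ler_piMr ?(exprn_ge0 _ (ltW p0))//; apply: (eucl_dist_shrunk_rhombus hp) => //.
rewrite /shrunk_rhombus /= normr0 mulr0 addr0 subr0 mulr_ge0//.
exact/ltW/koch_q_gt0.
Qed.

(** The pieces of level k with a coded point in U have their centres within p^k
of U, hence within 3 p^k of each other, and the centres are p^k / 2 apart: there
are at most 625 such pieces, each accounting for an interval of length 4^-k. *)
Lemma length_preimage (U : set (plane R)) k :
  (forall z w, U z -> U w -> eucl_dist z w <= p ^+ k) ->
  (length_outer (coding_preimage U) <= (625 / 4 ^+ k)%:E)%E.
Proof.
move=> Uk; set A := coding_preimage U; have pk0 : 0 < p ^+ k by rewrite exprn_gt0.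
have e40 : 0 < 4 ^+ k :> R by rewrite exprn_gt0.
pose P (n : 'I_(4 ^ k)) x := A x /\ address (digit x) k = n.
pose S : {set 'I_(4 ^ k)} := finset (fun n => `[< exists x, P n x >]).
pose x n := xget 0 (P n).
have xP n : n \in S -> P n (x n).
  by rewrite inE => /asboolP[y Pny]; exact: (xgetPex 0 (ex_intro _ y Pny)).
have pt n : n \in S -> exists2 z, U z & eucl_dist (centre p s (digit (x n)) k) z <= p ^+ k.
  move=> /xP[[_ [z Uz xz]] _]; exists z => //; exact: eucl_dist_centre.
have S625 : (#|S| <= 625)%N.
  apply: (@separated_card _ _ _ (fun n => centre p s (digit (x n)) k) (p ^+ k / 2)).
  - by rewrite divr_gt0.
  - move=> m n /xP[_ mE] /xP[_ nE] mn; apply: centre_separated => //.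
    by rewrite mE nE => /val_inj/eqP; apply/negP.
  - move=> m n /pt[z Uz mz] /pt[w Uw nw].
    have := le_trans (le_dx_eucl_dist _ _) mz; have := le_trans (le_dx_eucl_dist _ _) nw.
    have := le_trans (le_dx_eucl_dist _ _) (Uk _ _ Uz Uw).
    rewrite !ler_norml => /andP[? ?] /andP[? ?] /andP[? ?]; apply/andP; split; lra.
  - move=> m n /pt[z Uz mz] /pt[w Uw nw].
    have := le_trans (le_dy_eucl_dist _ _) mz; have := le_trans (le_dy_eucl_dist _ _) nw.
    have := le_trans (le_dy_eucl_dist _ _) (Uk _ _ Uz Uw).
    rewrite !ler_norml => /andP[? ?] /andP[? ?] /andP[? ?]; apply/andP; split; lra.
pose I (n : 'I_(4 ^ k)) := `[n%:R / 4 ^+ k, n.+1%:R / 4 ^+ k[%classic : set R.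
have /le_trans -> // : (length_outer A <= (#|S|%:R * (4 ^+ k)^-1)%:E)%E.
  apply: (length_outer_cover _ _ I).
    move=> n; rewrite length_outer_itv.
      by rewrite lee_fin -mulrBl -natr1 addrAC subrr add0r mul1r.
    by rewrite ler_pM2r ?invr_gt0// ler_nat.
  move=> y Ay; have [y01 _] := Ay; have y0 : 0 <= y by case/andP: y01.
  exists (Ordinal (address_lt (digit y) k)).
    by rewrite inE; apply/asboolP; exists y; split.
  rewrite /I /= in_itv /= ler_pdivrMr// ltr_pdivlMr// mulrC address_digit//.
  by rewrite truncn_itv// mulr_ge0// ltW.
by rewrite lee_fin ler_pM2r ?invr_gt0// (ler_nat _ _ 625).
Qed.

End preimage.
(** * Hausdorff measures of the curve *)

Section hausdorff.
Context {R : realType} (T : Type) (d : T -> T -> R).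
Implicit Types (U : set T) (r t : R).

Lemma diam_ge0 U : (0 <= diam d U)%E.
Proof. by apply: ereal_sup_ubound; left. Qed.

Lemma diam_le U r : 0 <= r -> (forall x y, U x -> U y -> d x y <= r) ->
  (diam d U <= r%:E)%E.
Proof.
move=> r0 Ur; apply: ge_ereal_sup => _ [->|[x Ux [y Uy <-]]]; rewrite lee_fin//.
exact: Ur.
Qed.

Lemma le_diam U r : (diam d U <= r%:E)%E -> forall x y, U x -> U y -> d x y <= r.
Proof.
move=> Ur x y Ux Uy; rewrite -lee_fin; apply: le_trans Ur.
by apply: ereal_sup_ubound; right; exists x => //; exists y.
Qed.

Lemma diam_pow_ge0 t U : (0 <= diam_pow d t U)%E.
Proof. by rewrite /diam_pow; case: ifP => // _; exact: poweR_ge0. Qed.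

Lemma diam_pow_le t r U : 0 <= t -> 0 <= r -> (diam d U <= r%:E)%E ->
  (diam_pow d t U <= (r `^ t)%:E)%E.
Proof.
move=> t0 r0 Ur; rewrite /diam_pow; case: ifP => [_|_].
  by rewrite lee_fin powR_ge0.
rewrite -poweR_EFin; apply: gt0_ler_poweR => //; rewrite in_itv /= andbC leey//=.
exact: diam_ge0.
Qed.

End hausdorff.

Section exponent.
Context {R : realType} {p : R} (hp : 1 / 4 < p <= 1 / 3).
Local Notation D := (ln 4 / ln p^-1).

Let p0 : 0 < p. Proof. by move: hp; lra. Qed.

Lemma ln_pV_gt0 : 0 < ln p^-1.
Proof. by apply: ln_gt0; rewrite invf_gt1//; move: hp; lra. Qed.

Lemma dimension_gt0 : 0 < D.
Proof. by rewrite divr_gt0 ?ln_pV_gt0// ln_gt0// ltr1n. Qed.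

Lemma powRE t : p `^ t = expR (- (t * ln p^-1)).
Proof. by rewrite /powR gt_eqF// lnV// mulrN opprK. Qed.

Lemma quarterE : 1 / 4 = expR (- ln 4) :> R.
Proof. by rewrite expRN lnK ?posrE// div1r. Qed.

(** D is the exponent with p^D = 1/4; p^t decreases in t. *)
Lemma powR_gt_quarter t : t < D -> 1 / 4 < p `^ t.
Proof. by rewrite powRE quarterE ltr_expR ltrN2 ltr_pdivlMr// ln_pV_gt0. Qed.

Lemma powR_lt_quarter t : D < t -> p `^ t < 1 / 4.
Proof. by rewrite powRE quarterE ltr_expR ltrN2 ltr_pdivrMr// ln_pV_gt0. Qed.

End exponent.

Lemma powR_expr {R : realType} (a t : R) k : 0 <= a ->
  (a ^+ k) `^ t = (a `^ t) ^+ k.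
Proof.
by move=> a0; rewrite -!powR_mulrn ?powR_ge0// -!powRrM mulrC.
Qed.

Lemma expr_lt_eventually {R : realType} (a e : R) : 0 <= a < 1 -> 0 < e ->
  exists k, a ^+ k < e.
Proof.
move=> /andP[a0 a1] e0.
have /cvgrPdist_lt/(_ _ e0)[k _ /(_ k (leqnn k))] : (GRing.exp a : nat -> R) @ \oo --> 0.
  by apply: cvg_expr; rewrite ger0_norm.
by rewrite sub0r normrN ger0_norm ?exprn_ge0//; exists k.
Qed.

Section upper.
Context {R : realType} {p : R} (hp : 1 / 4 < p <= 1 / 3) (s : signs).
Local Notation D := (ln 4 / ln p^-1).
Local Notation dist := (@eucl_dist R).

Let p0 : 0 < p. Proof. by move: hp; lra. Qed.

Lemma koch_curveE : koch_curve p s = [set z | exists u, coded_by s u (p := p) z].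
Proof.
rewrite /koch_curve (rhombusE hp); apply/seteqP; split=> [z [_ [u _ <-] uz]|z [u uz]].
  exists u => -[|k]; last exact: uz.
  exists z; last by rewrite /phi_word big_ord0.
  have [z' z'V <-] := uz 1%N isT.
  by have := phi_word_shrunk_rhombus hp (omega u s) 1 0 z' (lexx 0) z'V; rewrite mulr0.
by exists (omega u s); [exists u|move=> k _; exact: uz].
Qed.

(** The pieces of level k, indexed by their addresses; the sets of index at least
4^k are empty. *)
Definition level_cover k n : set (plane R) :=
  [set z | exists2 u, address u k = n &
    (phi_word p (omega u s) k @` shrunk_rhombus p 0) z].

Lemma level_cover_diam k n : (diam dist (level_cover k n) <= (p ^+ k)%:E)%E.
Proof.
apply: diam_le; first by rewrite exprn_ge0// ltW.
move=> _ _ [u <- [z zV <-]] [v /eq_phi_omega -> [w wV <-]].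
rewrite eucl_dist_phi_word// ler_piMr ?(exprn_ge0 _ (ltW p0))//.
exact: (eucl_dist_shrunk_rhombus hp).
Qed.

(** There are 4^k pieces, each contributing at most p^(k t). *)
Lemma hausdorff_content_le t k delta : 0 <= t -> p ^+ k <= delta ->
  (hausdorff_content dist t delta (koch_curve p s) <=
   ((4 * p `^ t) ^+ k)%:E)%E.
Proof.
move=> t0 kdelta.
apply: (@le_trans _ _ (\sum_(0 <= i <oo) diam_pow dist t (level_cover k i))%E).
  apply: ereal_inf_lbound; exists (level_cover k) => //; split.
    by move=> i; apply: le_trans (level_cover_diam _ _) _; rewrite lee_fin.
  by rewrite koch_curveE => z [u uz]; exists (address u k) => //; exists u.
rewrite (nneseries_split 0 (4 ^ k)); last by move=> *; exact: diam_pow_ge0.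
rewrite add0n eseries0 ?adde0; last first.
  move=> i ki _; rewrite /diam_pow ifT//; apply/eqP/seteqP; split => // z [u ui _].
  by have := address_lt u k; rewrite ui ltnNge ki.
apply: (@le_trans _ _ (\sum_(0 <= i < 4 ^ k) ((p ^+ k) `^ t)%:E)%E).
  apply: lee_sum => i _; apply: diam_pow_le => //; last exact: level_cover_diam.
  by rewrite exprn_ge0// ltW.
rewrite sumEFin sumr_const_nat subn0 lee_fin exprMn -[X in X <= _]mulr_natl natrX.
by rewrite powR_expr// ltW.
Qed.

Lemma hausdorff_measure_eq0 t : D < t ->
  hausdorff_measure dist t (koch_curve p s) = 0%E.
Proof.
move=> Dt; have t0 : 0 < t by apply: lt_trans Dt; exact: dimension_gt0.
have pt : 0 <= 4 * p `^ t < 1.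
  have := powR_lt_quarter hp _ Dt; have := powR_ge0 p t => ? ?.
  by apply/andP; split; lra.
have content0 delta : 0 < delta ->
    hausdorff_content dist t delta (koch_curve p s) = 0%E.
  move=> delta0; apply/le_anti/andP; split; last first.
    apply: le_ereal_inf_tmp => _ [U _ <-]; apply: nneseries_ge0 => *.
    exact: diam_pow_ge0.
  apply/lee_addgt0Pr => e e0; rewrite add0e.
  have [k1 k1e] := expr_lt_eventually _ _ pt e0.
  have p01 : 0 <= p < 1 by rewrite ltW//=; move: hp; lra.
  have [k2 k2d] := expr_lt_eventually _ _ p01 delta0.
  have kd : p ^+ (k1 + k2) <= delta.
    rewrite exprD; apply: le_trans (ltW k2d); rewrite ler_piMl ?(exprn_ge0 _ (ltW p0))//.
    by rewrite exprn_ile1//; case/andP: p01 => // _ /ltW.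
  apply: le_trans (hausdorff_content_le t _ _ (ltW t0) kd) _.
  rewrite lee_fin exprD; apply: le_trans (ltW k1e).
  case/andP: pt => pt0 /ltW pt1.
  by rewrite ler_piMr ?exprn_ge0// exprn_ile1.
rewrite /hausdorff_measure (_ : [set _ | _ in _] = [set 0%E]) ?ereal_sup1//.
apply/seteqP; split=> [_ [delta /= d0 <-]|_ ->]; first exact: content0.
by exists 1 => //=; exact: content0.
Qed.

End upper.

Section lower.
Context {R : realType} {p : R} (hp : 1 / 4 < p <= 1 / 3) (s : signs).
Local Notation D := (ln 4 / ln p^-1).
Local Notation dist := (@eucl_dist R).

Let p0 : 0 < p. Proof. by move: hp; lra. Qed.

(** Choose k with p^(k+1) < |U| <= p^k. Then the outer length is at most
625 / 4^k = 2500 (1/4)^(k+1), and (1/4)^(k+1) <= p^((k+1) t) <= |U|^t. When |U| = 0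
there is no such k, but every k is allowed in the bound 625 / 4^k. *)
Lemma length_preimage_diam t (U : set (plane R)) : 0 <= t -> t < D ->
  (diam dist U <= 1)%E ->
  (length_outer (coding_preimage s U (p := p)) <= 2500%:E * diam_pow dist t U)%E.
Proof.
move=> t0 tD U1.
have C0 : (0 <= 2500%:E * diam_pow dist t U)%E.
  by apply: mule_ge0; [rewrite lee_fin ler0n|exact: diam_pow_ge0].
have [U0|/set0P UN0] := eqVneq U set0.
  rewrite (_ : coding_preimage _ _ = set0) ?outer_measure0; last first.
    by apply/seteqP; split => // x [_ [z]]; rewrite U0.
  exact: C0.
have [r r0 dU] : exists2 r : R, 0 <= r & diam dist U = r%:E.
  move: U1 (diam_ge0 _ dist U); case: (diam dist U) => //= r _ r0.
  by exists r.
have Ur k : r <= p ^+ k ->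
    (length_outer (coding_preimage s U (p := p)) <= (625 / 4 ^+ k)%:E)%E.
  move=> rk; apply: length_preimage => // z w; apply: le_diam.
  by rewrite dU lee_fin.
have [rE0|rN0] := eqVneq r 0.
  apply: (@le_trans _ _ 0%E); last exact: C0.
  apply/lee_addgt0Pr => e e0; rewrite add0e.
  have e1 : 0 < e / 625 by apply: divr_gt0; [exact: e0|rewrite ltr0n].
  have [|k ke] := expr_lt_eventually (1 / 4 : R) _ _ e1; first by apply/andP; split; lra.
  apply: (le_trans (Ur k _)); first by rewrite rE0 exprn_ge0// ltW.
  by move: ke; rewrite lee_fin expr_div_n expr1n div1r ltr_pdivlMr ?ltr0n// mulrC => /ltW.
have r_gt0 : 0 < r by rewrite lt_neqAle eq_sym rN0.
have p01 : 0 <= p < 1 by rewrite ltW//=; move: hp; lra.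
have [k pk kmin] := ex_minnP (expr_lt_eventually _ _ p01 r_gt0).
case: k pk kmin => [|k] pk kmin.
  by move: U1; rewrite dU lee_fin leNgt -(expr0 p) pk.
have rk : r <= p ^+ k by rewrite leNgt; apply/negP => /kmin; rewrite ltnn.
apply: le_trans (Ur k rk) _.
rewrite /diam_pow (negbTE (introN eqP _)); last by case: UN0 => z Uz U0; rewrite U0 in Uz.
rewrite dU poweR_EFin -EFinM lee_fin.
have rt : (p `^ t) ^+ k.+1 <= r `^ t.
  rewrite -powR_expr ?(ltW p0)//.
  by apply: ge0_ler_powR => //; rewrite ?nnegrE ?exprn_ge0 ?ltW.
have : (1 / 4) ^+ k.+1 <= (p `^ t) ^+ k.+1.
  by rewrite lerXn2r ?nnegrE ?powR_ge0 ?divr_ge0// ltW// powR_gt_quarter.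
rewrite exprS expr_div_n expr1n div1r; lra.
Qed.

(** A cover with a sum of t-th powers below 1/2500 would cover [0, 1) by sets of
codes of total outer length less than 1. *)
Lemma le_of_hausdorff_measure_eq0 t : 0 <= t ->
  hausdorff_measure dist t (koch_curve p s) = 0%E -> D <= t.
Proof.
move=> t0 mt0; rewrite leNgt; apply/negP => tD.
have : (hausdorff_content dist t 1 (koch_curve p s) < (2500^-1)%:E)%E.
  apply: (@le_lt_trans _ _ 0%E); last by rewrite lte_fin invr_gt0 ltr0n.
  by rewrite -[leRHS]mt0; apply: ereal_sup_ubound; exists 1 => //=; exact: ltr01.
move=> /ereal_inf_lt[_ [U [Ud AU] <-] sumU].
pose E i := coding_preimage s (U i) (p := p).
have : (length_outer `[0%R, 1%R[%classic <= \sum_(0 <= i <oo) length_outer (E i))%E.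
  apply: (@le_trans _ _ (length_outer (\bigcup_i E i))); last first.
    exact: outer_measure_sigma_subadditive.
  apply: le_outer_measure => x /=; rewrite in_itv /= => x01.
  have [z xz] := nested_pieces hp (digit x) s.
  have [|i _ Uiz] := AU z; first by rewrite (koch_curveE hp); exists (digit x).
  by exists i => //; split => //; exists z.
rewrite length_outer_itv// subr0 leNgt => /negP; apply.
apply: (@le_lt_trans _ _ (2500%:E * \sum_(0 <= i <oo) diam_pow dist t (U i)))%E.
  rewrite -nneseriesZl; last by move=> *; exact: diam_pow_ge0.
  apply: lee_nneseries => i *; first exact: outer_measure_ge0.
  exact: length_preimage_diam.
by rewrite -lte_pdivlMl ?ltr0n// mule1.
Qed.

End lower.

Theorem proposition2p2 (R : realType) (p : R)
    (hp : 1 / 4 < p <= 1 / 3) (s : signs) :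
  hausdorff_dim (@eucl_dist R) (koch_curve p s) = (ln 4 / ln p^-1)%:E.
Proof.
apply/le_anti/andP; split.
  apply/lee_addgt0Pr => e e0; rewrite -EFinD.
  apply: ereal_inf_lbound; exists (ln 4 / ln p^-1 + e) => //; split.
    by rewrite addr_ge0// ltW// dimension_gt0.
  by apply: hausdorff_measure_eq0 => //; rewrite ltrDl.
apply: le_ereal_inf_tmp => _ [t [t0 mt0] <-].
by rewrite lee_fin; exact: le_of_hausdorff_measure_eq0 mt0.
Qed.
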